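(* Consider the Bayesian $k$-armed bandit problem described in the context, and suppose the prior $\Gamma$ is $1$-regular, i.e. there are constants $0<c_0<C_0$ with $c_0\epsilon\le \mathbb{P}_\Gamma(\mu>1-\epsilon)\le \mathbb{P}_\Gamma(\mu\ge 1-\epsilon)\le C_0\epsilon$ for all $\epsilon\in(0,1]$. Then there exist constants $c_D,c_L>0$, not depending on $T$, $k$ or the policy, such that for every policy $\pi$ and all $T,k\ge c_D$, $$BR_{T,k}(\pi)\ \ge\ c_L\min(\sqrt{T},k).$$
   Context: Bayesian $k$-armed bandit: time $t=1,\dots,T$ (horizon $T$), arms $[k]=\{1,\dots,k\}$. $\mathcal{F}=\{P_\mu:\mu\in[0,1]\}$ is a family of reward distributions, $P_\mu$ having mean $\mu$. $\Gamma$ is a prior on $[0,1]$, absolutely continuous with density $g$. The arm means $\mu_1,\dots,\mu_k$ are i.i.d. $\sim\Gamma$. Pulling arm $i$ at time $t$ yields reward $Y_{it}\sim P_{\mu_i}$, independent of all other randomness; only the reward $Y_{a_t,t}$ of the pulled arm $a_t$ is observed. A policy $\pi$ maps the history $H_t=(a_1,Y_{a_1,1},\dots,a_{t-1},Y_{a_{t-1},t-1})$ to a distribution over $[k]$, from which $a_t$ is drawn. Given $\bm\mu=(\mu_1,\dots,\mu_k)$, $R_T(\pi\mid\bm\mu)=T\max_i\mu_i-\sum_{t=1}^T\mathbb{E}[\mu_{a_t}\mid\pi]$, and the Bayesian regret is $BR_{T,k}(\pi)=\mathbb{E}[R_T(\pi\mid\bm\mu)]$, the expectation also over $\bm\mu\sim\Gamma^{\otimes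 k}$. *)

(* Defs.v *)
From HB Require Import structures.
From mathcomp Require Import all_boot all_order all_algebra.
From mathcomp Require Import all_classical all_reals all_analysis.
From mathcomp Require Import measurable_realfun.
Set Implicit Arguments. Unset Strict Implicit. Unset Printing Implicit Defensive.
Import Order.TTheory GRing.Theory Num.Theory.
Local Open Scope classical_set_scope.
Local Open Scope ring_scope.
Local Open Scope ereal_scope.

(* A policy for k arms: given the history H_t of length n = t-1, i.e. the
   chronological tuple of pulled arms s = (a_1,...,a_{t-1}) and of observed
   rewards y = (Y_{a_1,1},...,Y_{a_{t-1},t-1}), it returns the probability
   pi n s y a of pulling arm a at time t. *)
Definition policy (R : realType) (k : nat) :=
  forall n : nat, n.-tuple 'I_k -> n.-tuple R -> 'I_k -> R.

Definition is_policy (R : realType) (k : nat) (pi : policy R k) : Prop :=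
  [/\ (forall n s y a, (0 <= pi n s y a)%R),
      (forall n s y, (\sum_(a < k) pi n s y a)%R = 1%R) &
      (forall n (s : n.-tuple 'I_k) a,
          measurable_fun [set: n.-tuple R] (fun y => pi n s y a))].

(* future_reward P pi mu m n s y : expected value of sum_{t=n+1}^{n+m} mu_{a_t}
   given the current history (s,y) of length n, when arm i has mean mu_i,
   pulling arm a yields a reward drawn from P (mu_a), and arms are drawn
   according to pi.  (This is the law of the bandit process, written as the
   iterated (Ionescu-Tulcea) integral.) *)
Fixpoint future_reward (R : realType) (k : nat) (P : R -> probability R R)
    (pi : policy R k) (mu : k.-tuple R) (m n : nat)
    (s : n.-tuple 'I_k) (y : n.-tuple R) {struct m} : \bar R :=
  match m with
  | 0 => 0
  | m'.+1 =>
      \sum_(a < k) (pi n s y a)%:E *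
        ((tnth mu a)%:E +
         \int[P (tnth mu a)]_z
            future_reward P pi mu m' (rcons_tuple s a) (rcons_tuple y z))
  end.

Definition expected_total_reward (R : realType) (k : nat)
    (P : R -> probability R R) (pi : policy R k) (T : nat) (mu : k.-tuple R)
    : \bar R :=
  future_reward P pi mu T [tuple] [tuple].

Definition cond_regret (R : realType) (k : nat) (P : R -> probability R R)
    (pi : policy R k) (T : nat) (mu : k.-tuple R) : \bar R :=
  (T%:R * \big[Num.max/0%R]_(i < k) tnth mu i)%:E
  - expected_total_reward P pi T mu.

(* Expectation over mu = (mu_1,...,mu_k) i.i.d. ~ Gamma (supported on [0,1]),
   written as the iterated integral against Gamma^{(x) k}. *)
Fixpoint prior_expect (R : realType) (Gamma : probability R R) (n : nat)
    : (n.-tuple R -> \bar R) -> \bar R :=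
  match n with
  | 0 => fun F => F [tuple]
  | n'.+1 => fun F =>
      \int[Gamma]_(x in `[0%R, 1%R]%classic) prior_expect Gamma (fun t => F (cons_tuple x t))
  end.

Definition bayes_regret (R : realType) (k : nat) (Gamma : probability R R)
    (P : R -> probability R R) (pi : policy R k) (T : nat) : \bar R :=
  prior_expect Gamma (cond_regret P pi T).

Definition abs_cont_prior (R : realType) (Gamma : probability R R) : Prop :=
  Gamma `[0%R, 1%R]%classic = 1 /\ Gamma `<< (@lebesgue_measure R).

Definition one_regular (R : realType) (Gamma : probability R R) : Prop :=
  exists c0 C0 : R, (0 < c0)%R /\ (c0 < C0)%R /\
    forall eps : R, (0 < eps)%R -> (eps <= 1)%R ->
      (c0 * eps)%:E <= Gamma [set x : R | (1 - eps < x)%R] /\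
      Gamma [set x : R | (1 - eps < x)%R] <= Gamma [set x : R | (1 - eps <= x)%R] /\
      Gamma [set x : R | (1 - eps <= x)%R] <= (C0 * eps)%:E.

Definition reward_family (R : realType) (P : R -> probability R R) : Prop :=
  (forall m : R, m \in `[0%R, 1%R] ->
     (P m).-integrable [set: R] EFin /\ \int[P m]_y (y%:E) = m%:E) /\
  (forall A : set R, measurable A ->
     measurable_fun (`[0%R, 1%R]%classic : set R) (fun m : R => P m A)).

(* Main.v *)
(* Fix an arm i.  The probability p_i that arm i is ever pulled depends on the
   other means only, since before the first pull of i the policy has seen no
   reward of i.  Let S = sum_i E[p_i] be the expected number of explored arms.
   Exploring is costly: an arm with mean below 1 - 2h, for a constant h, costs
   at least h when the best mean exceeds 1 - h, so the regret is at least
   h S / 2 up to a constant.  Not exploring is costly too: for h of order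
   1 / min(sqrt T, k), some mean exceeds 1 - h with constant probability, while
   by independence the chance of ever pulling an arm with mean at least 1 - 2h
   is at most C_0 2h S; otherwise every step costs h.  The first bound handles
   S >= d min(sqrt T, k), the second one S < d min(sqrt T, k).  Rewards enter
   only through the measurability of their law: knowing mu_i after the first
   pull of i would not help the policy. *)

Require Import Defs.
From HB Require Import structures.
From mathcomp Require Import all_boot all_order all_algebra.
From mathcomp Require Import all_classical all_reals all_analysis.
From mathcomp Require Import measurable_realfun lra ring.
Import Order.TTheory GRing.Theory Num.Theory.
Local Open Scope classical_set_scope.
Local Open Scope ring_scope.
Set Implicit Arguments. Unset Strict Implicit. Unset Printing Implicit Defensive.

(** * Iterated expectation over the prior *)

Section prior_expectation.
Variables (R : realType) (Gamma : probability R R).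
Local Notation I01 := (`[0%R, 1%R]%classic).
Local Notation E := (@prior_expect R Gamma _).

Definition cube n (t : n.-tuple R) : Prop := forall i, tnth t i \in `[0, 1].

Lemma cube_cons n x (t : n.-tuple R) :
  x \in `[0, 1] -> cube t -> cube (cons_tuple x t).
Proof.
move=> x01 t01 i; case: (unliftP ord0 i) => [j ->|->]; last by rewrite tnth0.
by rewrite tnthS.
Qed.

Lemma measurable_cons_tuple d (X : measurableType d) n (f : X -> R)
    (g : X -> n.-tuple R) :
  measurable_fun setT f -> measurable_fun setT g ->
  measurable_fun setT (fun x => cons_tuple (f x) (g x)).
Proof. exact: measurable_cons. Qed.

Lemma prior_expect_eq n (F G : n.-tuple R -> \bar R) :
  (forall t, cube t -> F t = G t) -> E F = E G.
Proof.
elim: n F G => [|n IH] F G FG /=; first by apply: FG => -[].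
apply: eq_integral => x; rewrite inE /= => x01.
by apply: IH => t t01; apply: FG; exact: cube_cons.
Qed.

Lemma prior_expect_ge0 n (F : n.-tuple R -> \bar R) :
  (forall t, 0 <= F t)%E -> (0 <= E F)%E.
Proof.
elim: n F => [|n IH] F F0 //=.
by apply: integral_ge0 => x _; apply: IH.
Qed.

(** The parameter space [X] is arbitrary so that the induction can move the coordinate integrated
    first into the parameter, replacing [X] by [X * R]. *)
Lemma measurable_prior_expect n d (X : measurableType d)
    (G : X * n.-tuple R -> \bar R) :
  measurable_fun setT G -> (forall z, 0 <= G z)%E ->
  measurable_fun setT (fun x => E (fun t => G (x, t))).
Proof.
elim: n d X G => [|n IH] d X G mG G0 /=.
  by apply: (measurableT_comp mG); exact: measurable_fun_pair.
have mH : measurable_fun [set: X * R]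
    (fun z => E (fun t => G (z.1, cons_tuple z.2 t))).
  apply: (IH _ _ (fun w => G (w.1.1, cons_tuple w.1.2 w.2))) => [|z]; last exact: G0.
  apply: (measurableT_comp mG); apply: measurable_fun_pair => /=.
    exact: measurableT_comp.
  by apply: measurable_cons_tuple => //; exact: measurableT_comp.
(* Tonelli's theorem integrates over the whole line, so the restriction to [0,1] is encoded by
   extending with zero. *)
pose H : X * R -> \bar R :=
  (fun z => E (fun t => G (z.1, cons_tuple z.2 t))) \_ (setT `*` I01).
have mH' : measurable_fun setT H.
  apply/(measurable_restrictT _ (measurableX measurableT (measurable_itv `[0%R, 1%R]))).
  by apply: measurable_funTS.
have H0 z : (0 <= H z)%E.
  by rewrite /H patchE; case: ifP => // _; exact: prior_expect_ge0.
rewrite [X in measurable_fun _ X](_ : _ = fubini_F Gamma H).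
  exact: measurable_fun_fubini_tonelli_F.
apply/funext => x; rewrite /fubini_F [LHS]integral_mkcond; apply: eq_integral => y _.
by rewrite /H !patchE; congr (if _ then _ else _); rewrite in_setX in_setT.
Qed.

Lemma measurable_prior_expect_cons n (F : n.+1.-tuple R -> \bar R) (D : set R) :
  measurable_fun setT F -> (forall t, 0 <= F t)%E ->
  measurable_fun D (fun x => E (fun t => F (cons_tuple x t))).
Proof.
move=> mF F0; apply: measurable_funTS.
apply: (@measurable_prior_expect n _ _ (fun z => F (cons_tuple z.1 z.2))) => [|z].
  by apply: (measurableT_comp mF); apply: measurable_cons_tuple.
exact: F0.
Qed.

Lemma measurable_comp_cons n (F : n.+1.-tuple R -> \bar R) x :
  measurable_fun setT F -> measurable_fun setT (fun t => F (cons_tuple x t)).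
Proof.
by move=> mF; apply: (measurableT_comp mF); apply: measurable_cons_tuple.
Qed.

Lemma prior_expectD n (F G : n.-tuple R -> \bar R) :
  measurable_fun setT F -> (forall t, 0 <= F t)%E ->
  measurable_fun setT G -> (forall t, 0 <= G t)%E ->
  E (fun t => F t + G t)%E = (E F + E G)%E.
Proof.
elim: n F G => [|n IH] F G mF F0 mG G0 //=.
rewrite -ge0_integralD//; first last.
- exact: measurable_prior_expect_cons.
- by move=> x _; exact: prior_expect_ge0.
- exact: measurable_prior_expect_cons.
- by move=> x _; exact: prior_expect_ge0.
by apply: eq_integral => x _; rewrite IH//; exact: measurable_comp_cons.
Qed.

Lemma prior_expectZ n (F : n.-tuple R -> \bar R) (c : R) : 0 <= c ->
  measurable_fun setT F -> (forall t, 0 <= F t)%E ->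
  E (fun t => c%:E * F t)%E = (c%:E * E F)%E.
Proof.
move=> c0; elim: n F => [|n IH] F mF F0 //=.
rewrite -ge0_integralZl_EFin//; first last.
- exact: measurable_prior_expect_cons.
- by move=> x _; exact: prior_expect_ge0.
by apply: eq_integral => x _; rewrite IH//; exact: measurable_comp_cons.
Qed.

Lemma le_prior_expect n (F G : n.-tuple R -> \bar R) :
  measurable_fun setT F -> (forall t, 0 <= F t)%E ->
  measurable_fun setT G -> (forall t, 0 <= G t)%E ->
  (forall t, cube t -> F t <= G t)%E -> (E F <= E G)%E.
Proof.
elim: n F G => [|n IH] F G mF F0 mG G0 FG /=; first by apply: FG => -[].
apply: ge0_le_integral => //.
- by move=> x _; exact: prior_expect_ge0.
- exact: measurable_prior_expect_cons.
- exact: measurable_prior_expect_cons.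
move=> x /= x01; apply: IH => // [||t t01]; do ?exact: measurable_comp_cons.
by apply: FG; exact: cube_cons.
Qed.

Hypothesis Gamma01 : Gamma I01 = 1%E.

Lemma integral_cst01 (c : \bar R) : (\int[Gamma]_(x in I01) cst c x = c)%E.
Proof.
by rewrite integral_cst// -[RHS]mule1; congr (_ * _)%E; exact: Gamma01.
Qed.

Lemma prior_expect_cst n (c : \bar R) : E (fun _ : n.-tuple R => c) = c.
Proof.
elim: n => //= n IH; rewrite IH.
exact: integral_cst01.
Qed.

Lemma prior_expect_sum n (I : finType) (F : I -> n.-tuple R -> \bar R) :
  (forall i, measurable_fun setT (F i)) -> (forall i t, 0 <= F i t)%E ->
  E (fun t => \sum_i F i t)%E = (\sum_i E (F i))%E.
Proof.
move=> mF F0; elim: (index_enum I) => [|i s IH].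
  rewrite big_nil -[RHS](prior_expect_cst n).
  by apply: prior_expect_eq => t _; rewrite big_nil.
rewrite big_cons -IH -prior_expectD//; first last.
- by move=> t; apply: sume_ge0.
- exact: emeasurable_sum.
by apply: prior_expect_eq => t _; rewrite big_cons.
Qed.

Definition indep_coord n (i : 'I_n) (F : n.-tuple R -> \bar R) :=
  forall t t' : n.-tuple R,
    (forall j, j != i -> tnth t j = tnth t' j) -> F t = F t'.

(** Independence of the means: outer coordinates are peeled off until coordinate [i] is the
    outermost one. There the inner expectation of [F] is a constant and only the mass of [A] remains
    to be integrated. *)
Lemma prior_expect_indep n (i : 'I_n) (F : n.-tuple R -> \bar R) (A : set R) :
  measurable A -> measurable_fun setT F -> (forall t, 0 <= F t)%E ->
  indep_coord i F ->
  E (fun t => F t * (\1_A (tnth t i))%:E)%E = (E F * Gamma (A `&` I01))%E.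
Proof.
move=> mA; elim: n i F => [[]//|n IH] i F mF F0 Fi /=.
case: (unliftP ord0 i) Fi => [j ->{i}|->{i}] Fi.
  rewrite -ge0_integralZr//; first last.
  - by move=> x _; exact: prior_expect_ge0.
  - exact: measurable_prior_expect_cons.
  apply: eq_integral => x _; rewrite -(IH j); first last.
  - move=> t t' tt'; apply: Fi => l; case: (unliftP ord0 l) => [m ->|->] ml.
      by rewrite !tnthS; apply: tt'; apply: contra ml => /eqP ->.
    by rewrite !tnth0.
  - by move=> t; apply: F0.
  - exact: measurable_comp_cons.
  by apply: prior_expect_eq => t _; rewrite tnthS.
(* The 0 is an arbitrary filler for the coordinate that [F] ignores. *)
set G := fun t => F (cons_tuple 0 t).
have FG x t : F (cons_tuple x t) = G t.
  by apply: Fi => l; case: (unliftP ord0 l) => [m ->|->]; rewrite ?tnthS ?eqxx.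
transitivity (\int[Gamma]_(x in I01) ((\1_A x)%:E * E G))%E.
  apply: eq_integral => x _; rewrite indicE -prior_expectZ//; first last.
  - by move=> t; exact: F0.
  - exact: (measurable_comp_cons 0 mF).
  by apply: prior_expect_eq => t _; rewrite FG muleC.
rewrite ge0_integralZr//; first last.
- by apply: prior_expect_ge0 => t; exact: F0.
- apply/measurable_EFinP/measurable_funTS; exact: measurable_indic.
rewrite integral_indic// muleC; congr (_ * _)%E.
rewrite -[LHS]integral_cst01; apply: eq_integral => x _ /=.
by apply: prior_expect_eq => t _; rewrite FG.
Qed.

(** Used with [A := capped h], this is the probability that no mean exceeds 1 - h. *)
Lemma prior_expect_prod_indic n (A : set R) (q : R) :
  measurable A -> Gamma (A `&` I01) = q%:E ->
  E (fun t : n.-tuple R => (\prod_(i < n) \1_A (tnth t i))%:E)%E = (q ^+ n)%:E.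
Proof.
move=> mA Aq; elim: n => [|n IH] /=; first by rewrite big_ord0.
transitivity (\int[Gamma]_(x in I01) ((\1_A x)%:E * (q ^+ n)%:E))%E.
  apply: eq_integral => x _; rewrite -IH -prior_expectZ//; last first.
  - by move=> t; rewrite lee_fin prodr_ge0.
  - apply/measurable_EFinP; apply: measurable_prod => i _.
    by apply: measurableT_comp => //; exact: measurable_tnth.
  apply: prior_expect_eq => t _; rewrite big_ord_recl tnth0 EFinM.
  by congr (_ * _%:E)%E; apply: eq_bigr => i _; rewrite tnthS.
rewrite ge0_integralZr//; first last.
- rewrite lee_fin exprn_ge0// -lee_fin -Aq; exact: measure_ge0.
- apply/measurable_EFinP/measurable_funTS; exact: measurable_indic.
by rewrite integral_indic// exprS EFinM; congr (_ * _)%E.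
Qed.
End prior_expectation.

(** * Expected cumulated reward for an arbitrary per-step reward *)

Section reward_kernel.
Variables (R : realType) (P : R -> probability R R).
Hypothesis mP : forall A : set R, measurable A ->
  measurable_fun (`[0%R, 1%R]%classic : set R) (fun m : R => P m A).
Context d (X : measurableType d) (g : X -> R).
Hypotheses (mg : measurable_fun setT g) (g01 : forall x, g x \in `[0, 1]).

Let kappa (x : X) : {measure set R -> \bar R} := P (g x).

Let measurable_kappa A : measurable A -> measurable_fun setT (kappa ^~ A).
Proof.
move=> mA; apply: (@measurable_comp _ _ _ _ _ _ (`[0%R, 1%R]%classic : set R)
  (fun m => P m A) setT g) => //; last exact: mP.
by move=> _ [x _ <-] /=; exact: g01.
Qed.

HB.instance Definition _ := isKernel.Build _ _ _ _ R kappa measurable_kappa.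

Let kappa_setT x : kappa x setT = 1%E.
Proof. exact: probability_setT. Qed.

HB.instance Definition _ := Kernel_isProbability.Build _ _ _ _ R kappa kappa_setT.

(** Since [g] takes values in [0,1], where the reward laws are measurable in their mean, [kappa] is
    a probability kernel on all of [X]. *)
Lemma measurable_integral_reward (h : X * R -> \bar R) :
  (forall z, 0 <= h z)%E -> measurable_fun setT h ->
  measurable_fun setT (fun x => \int[P (g x)]_y h (x, y))%E.
Proof. by move=> h0 mh; exact: (@measurable_fun_integral_finite_kernel _ _ _ _ _ h kappa). Qed.

End reward_kernel.

Lemma measurable_rcons_tuple d (X : measurableType d) d' (Y : measurableType d')
    n (f : X -> n.-tuple Y) (g : X -> Y) :
  measurable_fun setT f -> measurable_fun setT g ->
  measurable_fun setT (fun x => rcons_tuple (f x) (g x)).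
Proof.
move=> mf mg; apply/measurable_fun_tnthP => i.
have [lt_in|] := ltnP i n.
  rewrite (_ : _ \o _ = (@tnth _ _ ^~ (Ordinal lt_in)) \o f).
    exact: measurableT_comp (measurable_tnth _) _.
  by apply/funext => x /=; rewrite !(tnth_nth (g x)) /= nth_rcons size_tuple lt_in.
move=> le_ni; rewrite (_ : _ \o _ = g) //.
apply/funext => x /=; rewrite (tnth_nth (g x)) /= nth_rcons size_tuple.
by rewrite ltnNge le_ni /=; case: eqP => // _; have := ltn_ord i.
Qed.

Lemma integral_probability_cst d (T : measurableType d) (R : realType)
    (Q : probability T R) (c : \bar R) : (\int[Q]_z cst c z = c)%E.
Proof.
by rewrite integral_cst// -[RHS]mule1; congr (_ * _)%E; exact: probability_setT.
Qed.

Section value.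
Variables (R : realType) (k : nat) (P : R -> probability R R) (pi : policy R k).
Hypothesis mP : forall A : set R, measurable A ->
  measurable_fun (`[0%R, 1%R]%classic : set R) (fun m : R => P m A).
Hypothesis pi_policy : is_policy pi.
Implicit Types (mu : k.-tuple R) (r : seq 'I_k -> 'I_k -> R).

(** The recursion of [future_reward] with a free reward [r s a], which may depend on the arms pulled
    so far, while observations still follow [mu]. Regret, pull probabilities and numbers of bad
    steps are all instances, to be compared through [r]. *)
Fixpoint value mu r m n (s : n.-tuple 'I_k) (y : n.-tuple R) {struct m} : \bar R :=
  match m with
  | 0 => 0%E
  | m'.+1 =>
      (\sum_(a < k) (pi s y a)%:E *
        ((r s a)%:E + \int[P (tnth mu a)]_z
           value mu r m' (rcons_tuple s a) (rcons_tuple y z)))%E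
  end.

Let pi_ge0 n (s : n.-tuple 'I_k) y a : 0 <= pi s y a.
Proof. by case: pi_policy => + _ _; exact. Qed.

Let pi_sum1 n (s : n.-tuple 'I_k) y : (\sum_(a < k) (pi s y a)%:E = 1)%E.
Proof. by case: pi_policy => _ + _; rewrite sumEFin => ->. Qed.

Lemma future_rewardE mu m n (s : n.-tuple 'I_k) y :
  future_reward P pi mu m s y = value mu (fun _ => tnth mu) m s y.
Proof.
elim: m n s y => //= m IH n s y; apply: eq_bigr => a _; congr (_ * (_ + _))%E.
by apply: eq_integral => z _; rewrite IH.
Qed.

Lemma value_ge0 mu r m n (s : n.-tuple 'I_k) y :
  (forall s a, 0 <= r s a) -> (0 <= value mu r m s y)%E.
Proof.
move=> r0; elim: m n s y => //= m IH n s y; apply: sume_ge0 => a _.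
apply: mule_ge0; first by rewrite lee_fin.
apply: adde_ge0; first by rewrite lee_fin.
by apply: integral_ge0 => z _; exact: IH.
Qed.

(** Measurability is joint in the parameter and the observed rewards, because the recursion
    integrates over the newest observation. *)
Lemma measurable_value m n (s : n.-tuple 'I_k) d (X : measurableType d)
    (f : X -> k.-tuple R) (r : X -> seq 'I_k -> 'I_k -> R) :
  measurable_fun setT f -> (forall x, cube (f x)) ->
  (forall s a, measurable_fun setT (fun x => r x s a)) ->
  (forall x s a, 0 <= r x s a) ->
  measurable_fun setT (fun z : X * n.-tuple R => value (f z.1) (r z.1) m s z.2).
Proof.
move=> mf f01 mr r0; elim: m n s => [|m IH] n s //=.
apply: emeasurable_sum => a; apply: emeasurable_funM.
  apply/measurable_EFinP; case: pi_policy => _ _ /(_ _ s a) mpi.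
  exact: (measurableT_comp mpi).
apply: emeasurable_funD.
  by apply/measurable_EFinP; exact: (measurableT_comp (mr s a)).
apply: (@measurable_integral_reward _ _ mP _ _ (fun z => tnth (f z.1) a) _ _
  (fun w => value (f w.1.1) (r w.1.1) m (rcons_tuple s a) (rcons_tuple w.1.2 w.2))).
- apply: (measurableT_comp (measurable_tnth _)); exact: measurableT_comp.
- by move=> z; exact: f01.
- by move=> z; exact: value_ge0.
have mg : measurable_fun setT
    (fun w : (X * n.-tuple R) * R => (w.1.1, rcons_tuple w.1.2 w.2)).
  apply: measurable_fun_pair; first exact: measurableT_comp.
  by apply: measurable_rcons_tuple => //; exact: measurableT_comp.
exact: (measurableT_comp (IH _ (rcons_tuple s a)) mg).
Qed.

(** * Linearity, monotonicity and first pulls for fixed means *)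

Section fixed_means.
Variable mu : k.-tuple R.
Hypothesis mu01 : cube mu.

Let mvalue r m n (s : n.-tuple 'I_k) : (forall s a, 0 <= r s a) ->
  measurable_fun setT (fun y => value mu r m s y).
Proof.
move=> r0; have mp : measurable_fun setT (fun y : n.-tuple R => (0 : R, y)).
  exact: measurable_fun_pair.
exact: (measurableT_comp (@measurable_value m n s _ R (fun _ => mu) (fun _ => r)
  (measurable_cst _) (fun _ => mu01) (fun s a => measurable_cst _) (fun _ => r0)) mp).
Qed.

Let mvalue_rcons r m n (s : n.+1.-tuple 'I_k) (y : n.-tuple R) :
  (forall s a, 0 <= r s a) ->
  measurable_fun setT (fun z => value mu r m s (rcons_tuple y z)).
Proof.
move=> r0; apply: (measurableT_comp (mvalue m s r0)).
exact: measurable_rcons_tuple.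
Qed.

Let integral_value_ge0 r m n (s : n.+1.-tuple 'I_k) (y : n.-tuple R) a :
  (forall s a, 0 <= r s a) ->
  (0 <= \int[P (tnth mu a)]_z value mu r m s (rcons_tuple y z))%E.
Proof. by move=> r0; apply: integral_ge0 => z _; exact: value_ge0. Qed.

Let step_ge0 r m n (s : n.-tuple 'I_k) (y : n.-tuple R) a :
  (forall s a, 0 <= r s a) ->
  (0 <= (r s a)%:E + \int[P (tnth mu a)]_z
     value mu r m (rcons_tuple s a) (rcons_tuple y z))%E.
Proof.
by move=> r0; apply: adde_ge0; [rewrite lee_fin|exact: integral_value_ge0].
Qed.

Lemma valueD r1 r2 m n (s : n.-tuple 'I_k) y :
  (forall s a, 0 <= r1 s a) -> (forall s a, 0 <= r2 s a) ->
  value mu (fun s a => r1 s a + r2 s a) m s y =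
  (value mu r1 m s y + value mu r2 m s y)%E.
Proof.
move=> r10 r20; elim: m n s y => [|m IH] n s y /=; first by rewrite adde0.
rewrite -big_split /=; apply: eq_bigr => a _.
under eq_integral do rewrite IH.
rewrite ge0_integralD//; first last.
- exact: mvalue_rcons.
- by move=> z _; exact: value_ge0.
- exact: mvalue_rcons.
- by move=> z _; exact: value_ge0.
rewrite -ge0_muleDr; [|exact: step_ge0..].
by rewrite EFinD addeACA.
Qed.

Lemma valueZ r c m n (s : n.-tuple 'I_k) y :
  0 <= c -> (forall s a, 0 <= r s a) ->
  value mu (fun s a => c * r s a) m s y = (c%:E * value mu r m s y)%E.
Proof.
move=> c0 r0; elim: m n s y => [|m IH] n s y /=; first by rewrite mule0.
rewrite ge0_sume_distrr; last first.
  by move=> a _; apply: mule_ge0; [rewrite lee_fin|exact: step_ge0].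
apply: eq_bigr => a _.
under eq_integral do rewrite IH.
rewrite ge0_integralZl_EFin//; first last.
- exact: mvalue_rcons.
- by move=> z _; exact: value_ge0.
rewrite muleCA; congr (_ * _)%E; rewrite EFinM -ge0_muleDr//.
  by rewrite lee_fin.
exact: integral_value_ge0.
Qed.

Lemma value_sum (I : Type) (l : seq I) (r : I -> seq 'I_k -> 'I_k -> R) m n
    (s : n.-tuple 'I_k) y :
  (forall i s a, 0 <= r i s a) ->
  value mu (fun s a => \sum_(i <- l) r i s a) m s y =
  (\sum_(i <- l) value mu (r i) m s y)%E.
Proof.
move=> r0; elim: l => [|i l IH].
  (* The zero reward is 0 times the reward 1, so homogeneity covers the empty sum. *)
  rewrite big_nil -[RHS](mul0e (value mu (fun _ _ => 1) m s y)) -valueZ//.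
  by congr (value mu _ m s y); apply/funext => s'; apply/funext => a; rewrite big_nil mul0r.
rewrite big_cons -IH -valueD//; last by move=> s' a; apply: sumr_ge0.
by congr (value mu _ m s y); apply/funext => s'; apply/funext => a; rewrite big_cons.
Qed.

Lemma le_value r1 r2 m n (s : n.-tuple 'I_k) y :
  (forall s a, 0 <= r1 s a) -> (forall s a, r1 s a <= r2 s a) ->
  (value mu r1 m s y <= value mu r2 m s y)%E.
Proof.
move=> r10 r12; have r20 s' a : 0 <= r2 s' a := le_trans (r10 s' a) (r12 s' a).
elim: m n s y => //= m IH n s y; apply: lee_sum => a _.
apply: lee_wpmul2l; rewrite ?lee_fin//; apply: leeD; rewrite ?lee_fin//.
apply: ge0_le_integral => //.
- by move=> z _; exact: value_ge0.
- exact: mvalue_rcons.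
- exact: mvalue_rcons.
Qed.

Lemma value_cst c m n (s : n.-tuple 'I_k) y :
  value mu (fun _ _ => c) m s y = (m%:R * c)%:E.
Proof.
elim: m n s y => [|m IH] n s y /=; first by rewrite mul0r.
transitivity (\sum_(a < k) (pi s y a)%:E * (m.+1%:R * c)%:E)%E.
  apply: eq_bigr => a _; under eq_integral do rewrite IH.
  by rewrite integral_probability_cst -EFinD -natr1 mulrDl mul1r addrC.
rewrite -ge0_sume_distrl; last by move=> a _; rewrite lee_fin.
by rewrite pi_sum1 mul1e.
Qed.

(** This reward is collected at most once along a trajectory, so its value is the probability that
    arm [i] is ever pulled. *)
Definition first_pull (i : 'I_k) (s : seq 'I_k) (a : 'I_k) : R :=
  ((a == i) && (i \notin s))%:R.

Lemma first_pull_ge0 i s a : 0 <= first_pull i s a.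
Proof. exact: ler0n. Qed.

Lemma value_first_pull0 i m n (s : n.-tuple 'I_k) y : i \in (s : seq 'I_k) ->
  value mu (first_pull i) m s y = 0%E.
Proof.
elim: m n s y => //= m IH n s y i_s; apply: big1 => a _.
rewrite /first_pull i_s andbF add0e integral0_eq ?mule0// => z _.
by rewrite IH//= mem_rcons inE i_s orbT.
Qed.

Lemma value_first_pull_le1 i m n (s : n.-tuple 'I_k) y :
  (value mu (first_pull i) m s y <= 1)%E.
Proof.
elim: m n s y => [|m IH] n s y; first by rewrite lee01.
have [i_s|i_s] := boolP (i \in (s : seq 'I_k)).
  by rewrite value_first_pull0// lee01.
rewrite -(pi_sum1 s y) /=; apply: lee_sum => a _.
rewrite -[leRHS]mule1; apply: lee_wpmul2l; rewrite ?lee_fin//.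
(* Pulling [i] now pays 1 and nothing afterwards; any other arm pays 0 now and at most 1 later by
   induction. *)
rewrite /first_pull i_s andbT; have [->|ai] := eqVneq a i.
  rewrite integral0_eq ?adde0// => z _.
  by rewrite value_first_pull0//= mem_rcons mem_head.
rewrite add0e -[leRHS](integral_probability_cst (P (tnth mu a))).
apply: ge0_le_integral => //.
- by move=> z _; apply: value_ge0; exact: first_pull_ge0.
- by apply: mvalue_rcons; exact: first_pull_ge0.
Qed.

(* Along a trajectory, either no arm of [B] is ever pulled and every step
   counts for 1, or the first pull of an arm of [B] counts for N >= m. *)
Lemma value_avoid_or_pull (B : pred 'I_k) (N : R) m n (s : n.-tuple 'I_k) y :
  m%:R <= N -> ~~ has B s ->
  (m%:R%:E <= value mu (fun s a => ((~~ B a)%:R +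
     \sum_(i < k | B i) N * first_pull i s a)%R) m s y)%E.
Proof.
set r := fun s a => _.
have r0 m' s' a : m'%:R <= N -> 0 <= r s' a.
  move=> m'N; rewrite addr_ge0//; apply: sumr_ge0 => i _.
  by rewrite mulr_ge0 ?first_pull_ge0//; apply: le_trans m'N.
elim: m n s y => [|m IH] n s y mN Bs //=.
have N0 : 0 <= N by apply: le_trans mN.
rewrite -[leLHS]mul1e -(pi_sum1 s y) ge0_sume_distrl; last by move=> a _; rewrite lee_fin.
apply: lee_sum => a _; apply: lee_wpmul2l; rewrite ?lee_fin//.
have int_ge0 : (0 <= \int[P (tnth mu a)]_z
    value mu r m (rcons_tuple s a) (rcons_tuple y z))%E.
  by apply: integral_value_ge0 => s' b; exact: r0 mN.
(* An arm of [B] is pulled here for the first time, so it pays [N] at once, which covers all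
   remaining steps. Any other arm pays 1 and keeps the history free of [B]. *)
have [Ba|Ba] := boolP (B a).
  rewrite -[leLHS]adde0 leeD// lee_fin (le_trans mN)// /r Ba add0r.
  rewrite (bigD1 a) //= /first_pull eqxx /=.
  have -> : a \notin (s : seq 'I_k) by apply: contra Bs => ?; apply/hasP; exists a.
  rewrite mulr1 lerDl; apply: sumr_ge0 => i _.
  by rewrite mulr_ge0 ?first_pull_ge0.
rewrite -natr1 addrC EFinD leeD//.
  rewrite lee_fin /r Ba lerDl; apply: sumr_ge0 => i _.
  by rewrite mulr_ge0 ?first_pull_ge0.
rewrite -[leLHS](integral_probability_cst (P (tnth mu a))); apply: ge0_le_integral => //.
- by move=> z _; rewrite lee_fin.
- by apply: mvalue_rcons => s' b; exact: r0 mN.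
move=> z _; apply: IH; first by apply: le_trans mN; rewrite ler_nat.
by rewrite /= has_rcons negb_or Ba.
Qed.

End fixed_means.

(** The mean of arm [i] affects observations only once [i] is pulled, and from then on the value is
    zero on both sides. *)
Lemma value_first_pull_indep i mu mu' m n (s : n.-tuple 'I_k) y :
  (forall j, j != i -> tnth mu j = tnth mu' j) ->
  value mu (first_pull i) m s y = value mu' (first_pull i) m s y.
Proof.
move=> mumu'; elim: m n s y => //= m IH n s y; apply: eq_bigr => a _.
congr (_ * (_ + _))%E; have [->|ai] := eqVneq a i.
  by rewrite !integral0_eq// => z _;
    rewrite value_first_pull0//= mem_rcons mem_head.
by rewrite mumu'//; apply: eq_integral => z _; rewrite IH.
Qed.

End value.

(** * Regret bounds for fixed means *)

(* The reward kernel is measurable on [0, 1] only, hence the means are clamped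
   to that interval wherever measurability in the means is needed. *)
Section clamp.
Variable R : realType.

Definition clamp (x : R) : R := Num.max 0 (Num.min x 1).

Lemma clamp_in01 x : clamp x \in `[0, 1].
Proof. by rewrite in_itv /= le_max lexx /= ge_max ler01 ge_min lexx orbT. Qed.

Lemma clamp_id x : x \in `[0, 1] -> clamp x = x.
Proof. by rewrite in_itv /= /clamp => /andP[x0 x1]; rewrite min_l// max_r. Qed.

Definition clamp_tuple n (t : n.-tuple R) := map_tuple clamp t.

Lemma cube_clamp n (t : n.-tuple R) : cube (clamp_tuple t).
Proof. by move=> i; rewrite tnth_map clamp_in01. Qed.

Lemma clamp_tuple_id n (t : n.-tuple R) : cube t -> clamp_tuple t = t.
Proof. by move=> t01; apply: eq_from_tnth => i; rewrite tnth_map clamp_id. Qed.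

Lemma measurable_clamp_tuple n :
  measurable_fun setT (@clamp_tuple n).
Proof.
apply/measurable_fun_tnthP => i.
rewrite (_ : _ \o _ = (cst 0) \max ((@tnth _ R ^~ i) \min cst 1)); last first.
  by apply/funext => t /=; rewrite tnth_map.
apply: measurable_maxr => //; apply: measurable_minr => //.
exact: measurable_tnth.
Qed.
End clamp.

Section regret.
Variables (R : realType) (k : nat) (P : R -> probability R R) (pi : policy R k).
Hypothesis mP : forall A : set R, measurable A ->
  measurable_fun (`[0%R, 1%R]%classic : set R) (fun m : R => P m A).
Hypothesis pi_policy : is_policy pi.
Variable T : nat.
Implicit Types mu : k.-tuple R.

Definition best mu : R := \big[Num.max/0]_(i < k) tnth mu i.

Lemma le_best mu i : tnth mu i <= best mu.
Proof. by rewrite /best; exact: le_bigmax. Qed.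

Lemma measurable_best : measurable_fun setT best.
Proof.
rewrite /best; elim: (index_enum _) => [|i s IH].
  by under eq_fun do rewrite big_nil; exact: measurable_cst.
under eq_fun do rewrite big_cons.
apply: measurable_maxr => //; exact: measurable_tnth.
Qed.

(** Summing gaps step by step, rather than subtracting a total reward, gives a quantity that is
    nonnegative for all [mu] and comparable with other values. *)
Definition regret mu : \bar R :=
  value P pi mu (fun _ a => best mu - tnth mu a) T [tuple] [tuple].

Definition pull_prob (i : 'I_k) mu : \bar R :=
  value P pi mu (first_pull R i) T [tuple] [tuple].

Lemma gap_ge0 mu a : 0 <= best mu - tnth mu a.
Proof. by rewrite subr_ge0 le_best. Qed.

Lemma regret_ge0 mu : (0 <= regret mu)%E.
Proof. by apply: value_ge0 => // _ a; exact: gap_ge0. Qed.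

Lemma pull_prob_ge0 i mu : (0 <= pull_prob i mu)%E.
Proof. by apply: value_ge0 => // s a; exact: first_pull_ge0. Qed.

(** Gap plus mean is the constant [best mu] at every step, so the regret and the total reward add up
    to T times the best mean. The total reward is at most T, hence finite, and can be subtracted. *)
Lemma cond_regretE mu : cube mu -> cond_regret P pi T mu = regret mu.
Proof.
move=> mu01; rewrite /cond_regret /expected_total_reward future_rewardE.
have mu0 (_ : seq 'I_k) a : 0 <= tnth mu a.
  by have := mu01 a; rewrite in_itv /= => /andP[].
set V := value P pi mu _ T _ _.
have V_fin : V \is a fin_num.
  rewrite ge0_fin_numE; last exact: value_ge0.
  apply: (@le_lt_trans _ _ (value P pi mu (fun _ _ => 1) T [tuple] [tuple])).
    apply: le_value => // _ a.
    by have := mu01 a; rewrite in_itv /= => /andP[].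
  by rewrite value_cst// ltry.
have : (regret mu + V = (T%:R * best mu)%:E)%E.
  rewrite -(value_cst P pi_policy mu (best mu) T [tuple] [tuple]).
  rewrite -valueD//; last by move=> _ a; exact: gap_ge0.
  by congr (value P pi mu _ T [tuple] [tuple]); apply/funext => s; apply/funext => a; rewrite subrK.
by move=> <-; rewrite addeK.
Qed.

Lemma measurable_value_clamp (r : k.-tuple R -> seq 'I_k -> 'I_k -> R) :
  (forall s a, measurable_fun setT (fun mu => r mu s a)) ->
  (forall mu s a, 0 <= r mu s a) ->
  measurable_fun setT
    (fun mu => value P pi (clamp_tuple mu) (r mu) T [tuple] [tuple]).
Proof.
move=> mr r0.
have mp : measurable_fun setT (fun mu : k.-tuple R => (mu, [tuple] : 0.-tuple R)).
  exact: measurable_fun_pair.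
exact: (measurableT_comp (measurable_value mP pi_policy T [tuple]
  (@measurable_clamp_tuple R k) (@cube_clamp R k) mr r0) mp).
Qed.

Lemma measurable_regret :
  measurable_fun setT (fun mu => regret (clamp_tuple mu)).
Proof.
apply: measurable_value_clamp => [_ a|mu _ a]; last exact: gap_ge0.
have mc := @measurable_clamp_tuple R k.
apply: measurable_funB; first exact: (measurableT_comp measurable_best mc).
exact: (measurableT_comp (measurable_tnth a) mc).
Qed.

Lemma measurable_pull_prob i :
  measurable_fun setT (fun mu => pull_prob i (clamp_tuple mu)).
Proof.
by apply: measurable_value_clamp => // mu s a; exact: first_pull_ge0.
Qed.

Lemma pull_prob_indep i : indep_coord i (fun mu => pull_prob i (clamp_tuple mu)).
Proof.
move=> t t' tt'; apply: value_first_pull_indep => j ji.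
by rewrite !tnth_map tt'.
Qed.

(** Only the term of the arm pulled now can be nonzero, so a charge per newly explored arm is at
    most a charge per step. *)
Lemma sum_first_pull (w : 'I_k -> R) s a :
  (forall i, 0 <= w i) -> \sum_(i < k) w i * first_pull R i s a <= w a.
Proof.
move=> w0; rewrite (bigD1 a)//= big1 => [|i ia]; last first.
  by rewrite /first_pull eq_sym (negbTE ia) mulr0.
by rewrite addr0 ler_piMr// /first_pull lern1 leq_b1.
Qed.

Lemma value_sum_first_pull mu (w : 'I_k -> R) : cube mu ->
  (forall i, 0 <= w i) ->
  value P pi mu (fun s a => \sum_(i < k) w i * first_pull R i s a) T [tuple] [tuple] =
  (\sum_(i < k) (w i)%:E * pull_prob i mu)%E.
Proof.
move=> mu01 w0; rewrite value_sum//; last first.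
  by move=> i s a; rewrite mulr_ge0 ?first_pull_ge0.
by apply: eq_bigr => i _; rewrite valueZ// => s a; exact: first_pull_ge0.
Qed.

(** The means are split at 1 - 2h and the best mean is compared with 1 - h, which leaves a gap of at
    least h for arms in [below h]. *)
Definition below (h : R) : set R := [set x | x < 1 - 2 * h].
Definition above (h : R) : set R := [set x | 1 - 2 * h <= x].
Definition capped (h : R) : set R := [set x | x <= 1 - h].
Definition all_capped h mu : R := \prod_(i < k) \1_(capped h) (tnth mu i).

Lemma all_capped_ge0 h mu : 0 <= all_capped h mu.
Proof. by apply: prodr_ge0 => i _; rewrite indicE. Qed.

Lemma all_cappedP h mu :
  all_capped h mu = 1 \/ 1 - h < best mu.
Proof.
have [capped_mu|] := pselect (forall i, tnth mu i <= 1 - h).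
  left; apply: big1 => i _; rewrite indicE mem_set//=; exact: capped_mu.
move=> /existsNP[i /negP]; rewrite -ltNge => mui.
by right; apply: lt_le_trans mui (le_best mu i).
Qed.

(** If some mean exceeds 1 - h, each first pull of an arm in [below h] costs at least h. Otherwise
    the last term pays for all arms, each being pulled with probability at most 1. *)
Lemma exploration_bound h mu : 0 <= h -> cube mu ->
  (h%:E * (\sum_(i < k) pull_prob i mu * (\1_(below h) (tnth mu i))%:E) <=
   regret mu + (h * k%:R)%:E * (all_capped h mu)%:E)%E.
Proof.
move=> h0 mu01.
have [->|best_h] := all_cappedP h mu.
  rewrite mule1 -[leLHS]add0e; apply: leeD; first exact: regret_ge0.
  rewrite EFinM; apply: lee_wpmul2l; rewrite ?lee_fin//.
  apply: (@le_trans _ _ (\sum_(i < k) 1)%E).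
    apply: lee_sum => i _; rewrite -[leRHS]mule1.
    apply: lee_pmul; first exact: pull_prob_ge0.
    - by rewrite lee_fin indicE.
    - exact: value_first_pull_le1.
    - by rewrite lee_fin indicE lern1 leq_b1.
  by rewrite sumEFin sumr_const card_ord.
rewrite -[leLHS]adde0; apply: leeD; last first.
  by apply: mule_ge0; rewrite lee_fin ?mulr_ge0 ?all_capped_ge0.
have w0 i : 0 <= h * \1_(below h) (tnth mu i) by rewrite mulr_ge0// indicE.
rewrite ge0_sume_distrr => [|i _]; last first.
  by rewrite mule_ge0 ?lee_fin ?indicE// pull_prob_ge0.
under eq_bigr do rewrite muleCA muleC -EFinM.
rewrite -value_sum_first_pull//; apply: le_value => // [s a|s a].
  by apply: sumr_ge0 => i _; rewrite mulr_ge0 ?first_pull_ge0.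
apply: le_trans (sum_first_pull _ _ w0) _; rewrite indicE.
have [|_] := boolP (_ \in _); last by rewrite mulr0 gap_ge0.
by rewrite inE /below /= => mua; lra.
Qed.

(** If some mean exceeds 1 - h, each step on an arm outside [above h] costs at least h. The first
    pull of an arm in [above h] is charged as if it saved all T steps. *)
Lemma exploitation_bound h mu : 0 <= h -> cube mu ->
  ((T%:R * h)%:E <=
   regret mu +
   (T%:R * h)%:E * (\sum_(i < k) pull_prob i mu * (\1_(above h) (tnth mu i))%:E) +
   (T%:R * h)%:E * (all_capped h mu)%:E)%E.
Proof.
move=> h0 mu01; have Th0 : 0 <= T%:R * h by rewrite mulr_ge0.
have S_ge0 : (0 <= \sum_(i < k) pull_prob i mu * (\1_(above h) (tnth mu i))%:E)%E.
  by apply: sume_ge0 => i _; rewrite mule_ge0 ?lee_fin ?indicE// pull_prob_ge0.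
have [->|best_h] := all_cappedP h mu.
  rewrite mule1 -[leLHS]add0e; apply: leeD => //.
  by apply: adde_ge0; [exact: regret_ge0|rewrite mule_ge0].
rewrite -[leLHS]adde0; apply: leeD; last first.
  by apply: mule_ge0; rewrite lee_fin ?all_capped_ge0.
pose B i := tnth mu i \in above h.
have w0 i : 0 <= T%:R * \1_(above h) (tnth mu i) by rewrite mulr_ge0// indicE.
have fp0 (w : 'I_k -> R) (s : seq 'I_k) a : (forall i, 0 <= w i) ->
    0 <= \sum_(i < k) w i * first_pull R i s a.
  by move=> ?; apply: sumr_ge0 => i _; rewrite mulr_ge0 ?first_pull_ge0.
have := value_avoid_or_pull mP pi_policy mu01 (B := B) (s := [tuple]) [tuple]
  (lexx (T%:R : R)) isT.
(* The sum over [B] becomes a weighted sum over all arms, as [value_sum_first_pull] requires. *)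
rewrite (_ : (fun s a => _) = (fun s a => (~~ B a)%:R +
    \sum_(i < k) (T%:R * \1_(above h) (tnth mu i)) * first_pull R i s a)); last first.
  apply/funext => s; apply/funext => a; congr (_ + _); rewrite big_mkcond.
  by apply: eq_bigr => i _; rewrite indicE /B; case: ifP; rewrite ?mulr1 ?mulr0 ?mul0r.
rewrite valueD//; last by move=> s a; exact: fp0.
rewrite value_sum_first_pull// => /(lee_wpmul2l (x := h%:E)).
rewrite lee_fin => /(_ h0); rewrite -EFinM mulrC => /le_trans; apply.
rewrite ge0_muleDr; first last.
- by apply: sume_ge0 => i _; rewrite mule_ge0 ?lee_fin// pull_prob_ge0.
- exact: value_ge0.
rewrite -valueZ//; apply: leeD.
  apply: le_value => // [_ a|_ a]; first by rewrite mulr_ge0.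
  rewrite /B; have [_|] := boolP (_ \in _); first by rewrite mulr0 gap_ge0.
  by rewrite notin_setE /above /= => /negP; rewrite -ltNge => mua; lra.
rewrite mulrC EFinM -muleA; apply: lee_wpmul2l; first by rewrite lee_fin.
rewrite ge0_sume_distrr => [|i _]; last first.
  by rewrite mule_ge0 ?lee_fin ?indicE// pull_prob_ge0.
by apply: lee_sum => i _; rewrite EFinM -muleA [(_ * pull_prob _ _)%E]muleC.
Qed.
End regret.

(** * Bayesian regret *)

Section bayes.
Variables (R : realType) (Gamma : probability R R) (P : R -> probability R R).
Hypothesis Gamma01 : Gamma `[0%R, 1%R]%classic = 1%E.
Hypothesis mP : forall A : set R, measurable A ->
  measurable_fun (`[0%R, 1%R]%classic : set R) (fun m : R => P m A).
Variables (k : nat) (pi : policy R k).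
Hypothesis pi_policy : is_policy pi.
Variable T : nat.
Local Notation I01 := (`[0%R, 1%R]%classic).
Local Notation E := (@prior_expect R Gamma k).

Let p i (mu : k.-tuple R) := pull_prob P pi T i (clamp_tuple mu).
Let Reg (mu : k.-tuple R) := regret P pi T (clamp_tuple mu).

(** The expected number of distinct arms pulled within [T] steps. *)
Definition pulls : \bar R := (\sum_(i < k) E (p i))%E.

Lemma bayes_regretE : bayes_regret Gamma P pi T = E Reg.
Proof.
apply: prior_expect_eq => mu mu01.
by rewrite cond_regretE// /Reg clamp_tuple_id.
Qed.

Let mp i : measurable_fun setT (p i). Proof. exact: measurable_pull_prob. Qed.
Let p_ge0 i mu : (0 <= p i mu)%E. Proof. exact: pull_prob_ge0. Qed.
Let mReg : measurable_fun setT Reg. Proof. exact: measurable_regret. Qed.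
Let Reg_ge0 mu : (0 <= Reg mu)%E. Proof. exact: regret_ge0. Qed.

Lemma bayes_regret_ge0 : (0 <= bayes_regret Gamma P pi T)%E.
Proof. by rewrite bayes_regretE; apply: prior_expect_ge0. Qed.

Lemma pulls_ge0 : (0 <= pulls)%E.
Proof. by apply: sume_ge0 => i _; exact: prior_expect_ge0. Qed.

Lemma pulls_le : (pulls <= k%:R%:E)%E.
Proof.
apply: (@le_trans _ _ (\sum_(i < k) 1)%E).
  apply: lee_sum => i _; rewrite -(prior_expect_cst Gamma01 k 1).
  apply: le_prior_expect => // mu _; rewrite /p.
  by apply: value_first_pull_le1 => //; exact: cube_clamp.
by rewrite sumEFin sumr_const card_ord.
Qed.

Lemma measurable_below h : measurable (below h : set R).
Proof. by rewrite (_ : below h = `]-oo, (1 - 2 * h)[%classic); [exact: measurable_itv|rewrite set_itvE]. Qed.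

Lemma measurable_above h : measurable (above h : set R).
Proof. by rewrite (_ : above h = `[(1 - 2 * h), +oo[%classic); [exact: measurable_itv|rewrite set_itvE]. Qed.

Lemma measurable_capped h : measurable (capped h : set R).
Proof. by rewrite (_ : capped h = `]-oo, (1 - h)]%classic); [exact: measurable_itv|rewrite set_itvE]. Qed.

Let measurable_prod_indic (A : set R) : measurable A ->
  measurable_fun setT (fun mu : k.-tuple R => (\prod_(i < k) (\1_A (tnth mu i) : R))%:E).
Proof.
move=> mA; apply/measurable_EFinP; apply: measurable_prod => i _.
by apply: measurableT_comp => //; exact: measurable_tnth.
Qed.

Let pi_indic_ge0 A i mu : (0 <= p i mu * (\1_A (tnth mu i))%:E)%E.
Proof. by apply: mule_ge0 => //; rewrite lee_fin indicE. Qed.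

Let measurable_p_indic (A : set R) i : measurable A ->
  measurable_fun setT (fun mu : k.-tuple R => p i mu * (\1_A (tnth mu i))%:E)%E.
Proof.
move=> mA; apply: emeasurable_funM; first exact: mp.
by apply/measurable_EFinP; apply: measurableT_comp => //; exact: measurable_tnth.
Qed.

Let sum_ge0 A mu : (0 <= \sum_(i < k) p i mu * (\1_A (tnth mu i))%:E)%E.
Proof. by apply: sume_ge0 => i _; exact: pi_indic_ge0. Qed.

Let measurable_sum_p (A : set R) : measurable A -> measurable_fun setT
  (fun mu : k.-tuple R => \sum_(i < k) p i mu * (\1_A (tnth mu i))%:E)%E.
Proof. by move=> mA; apply: emeasurable_sum => i; exact: measurable_p_indic. Qed.

(** The probability of pulling arm [i] does not depend on its own mean, so each summand factors. *)
Let expect_sum (A : set R) : measurable A ->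
  E (fun mu => \sum_(i < k) p i mu * (\1_A (tnth mu i))%:E)%E =
  (pulls * Gamma (A `&` I01))%E.
Proof.
move=> mA; rewrite prior_expect_sum//; last by move=> i; exact: measurable_p_indic.
rewrite ge0_sume_distrl; last by move=> i _; exact: prior_expect_ge0.
apply: eq_bigr => i _; apply: prior_expect_indep => //.
exact: pull_prob_indep.
Qed.

Lemma bayes_exploration_bound h q : 0 <= h -> Gamma (capped h `&` I01) = q%:E ->
  (h%:E * (pulls * Gamma (below h `&` I01)) <=
   bayes_regret Gamma P pi T + (h * k%:R * q ^+ k)%:E)%E.
Proof.
move=> h0 hq; have mb := measurable_below h; have mc := measurable_capped h.
have hk0 : 0 <= h * k%:R by rewrite mulr_ge0.
rewrite bayes_regretE -expect_sum// -prior_expectZ//; last exact: measurable_sum_p.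
rewrite EFinM -(prior_expect_prod_indic k mc hq) -prior_expectZ//; first last.
- by move=> mu; rewrite lee_fin all_capped_ge0.
- exact: measurable_prod_indic.
rewrite -prior_expectD//; first last.
- by move=> mu; rewrite mule_ge0 ?lee_fin ?all_capped_ge0.
- by apply: emeasurable_funM => //; exact: measurable_prod_indic.
apply: le_prior_expect.
- by apply: emeasurable_funM => //; exact: measurable_sum_p.
- by move=> mu; rewrite mule_ge0.
- apply: emeasurable_funD => //.
  by apply: emeasurable_funM => //; exact: measurable_prod_indic.
- by move=> mu; apply: adde_ge0 => //; rewrite mule_ge0 ?lee_fin ?all_capped_ge0.
move=> mu mu01; rewrite /p /Reg clamp_tuple_id//; exact: exploration_bound.
Qed.

Lemma bayes_exploitation_bound h q : 0 <= h -> Gamma (capped h `&` I01) = q%:E ->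
  ((T%:R * h)%:E <= bayes_regret Gamma P pi T +
     (T%:R * h)%:E * (pulls * Gamma (above h `&` I01)) +
     (T%:R * h * q ^+ k)%:E)%E.
Proof.
move=> h0 hq; have mb := measurable_above h; have mc := measurable_capped h.
have Th0 : 0 <= T%:R * h by rewrite mulr_ge0.
rewrite bayes_regretE -expect_sum// -prior_expectZ//; last exact: measurable_sum_p.
rewrite [(_ * q ^+ k)%:E]EFinM -(prior_expect_prod_indic k mc hq) -[X in (_ + X)%E]prior_expectZ//; first last.
- by move=> mu; rewrite lee_fin all_capped_ge0.
- exact: measurable_prod_indic.
have m1 : measurable_fun setT (fun mu => (T%:R * h)%:E *
    \sum_(i < k) p i mu * (\1_(above h) (tnth mu i))%:E)%E.
  by apply: emeasurable_funM => //; exact: measurable_sum_p.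
have m2 : measurable_fun setT (fun mu : k.-tuple R => (T%:R * h)%:E *
    (\prod_(i < k) \1_(capped h) (tnth mu i))%:E)%E.
  by apply: emeasurable_funM => //; exact: measurable_prod_indic.
rewrite -prior_expectD//; last by move=> mu; rewrite mule_ge0.
rewrite -prior_expectD//; first last.
- by move=> mu; rewrite mule_ge0 ?lee_fin ?all_capped_ge0.
- by move=> mu; apply: adde_ge0 => //; rewrite mule_ge0.
- exact: emeasurable_funD.
rewrite -[leLHS](prior_expect_cst Gamma01 k).
apply: le_prior_expect => //.
- by apply: emeasurable_funD => //; exact: emeasurable_funD.
- move=> mu; apply: adde_ge0; first by apply: adde_ge0 => //; rewrite mule_ge0.
  by rewrite mule_ge0 ?lee_fin ?all_capped_ge0.
move=> mu mu01; rewrite /p /Reg clamp_tuple_id//; exact: exploitation_bound.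
Qed.
End bayes.

(** * Prior masses under 1-regularity *)

Section regular.
Variables (R : realType) (Gamma : probability R R) (c0 C0 : R).
Hypothesis Gamma01 : Gamma `[0%R, 1%R]%classic = 1%E.
Hypothesis reg : forall eps : R, 0 < eps -> eps <= 1 ->
  ((c0 * eps)%:E <= Gamma [set x : R | (1 - eps < x)%R])%E /\
  (Gamma [set x : R | (1 - eps <= x)%R] <= (C0 * eps)%:E)%E.
Local Notation I01 := (`[0%R, 1%R]%classic).

Lemma prior_capped_le h : 0 < h -> h <= 1 ->
  (Gamma (capped h `&` I01) <= (1 - c0 * h)%:E)%E.
Proof.
move=> h0 h1; have [+ _] := reg h0 h1.
have mc := measurable_capped h.
have -> : [set x : R | (1 - h < x)%R] = ~` capped h.
  by apply/seteqP; split => x /=; rewrite ltNge => /negP.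
rewrite probability_setC// => H.
apply: (@le_trans _ _ (Gamma (capped h))).
  by apply: le_measure => //; rewrite ?inE//; exact: measurableI.
move: H; rewrite -(fineK (fin_num_measure Gamma _ mc)) -EFinB !lee_fin; lra.
Qed.

Lemma prior_above_le h : 0 < h -> 2 * h <= 1 ->
  (Gamma (above h `&` I01) <= (C0 * (2 * h))%:E)%E.
Proof.
move=> h0 h1; have [|_] := reg _ h1; first by rewrite mulr_gt0.
apply: le_trans; apply: le_measure; rewrite ?inE//.
  by apply: measurableI => //; exact: measurable_above.
exact: measurable_above.
Qed.

(** Within [0,1] the sets [below h] and [above h] are complementary, and the latter has mass at most
    1/2. *)
Lemma prior_below_ge h : 0 < h -> 2 * h <= 1 -> C0 * (2 * h) <= 2^-1 ->
  (2^-1%:E <= Gamma (below h `&` I01))%E.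
Proof.
move=> h0 h1 h2; have := prior_above_le h0 h1.
have ma := measurable_above h; have mb := measurable_below h.
have : (Gamma (below h `&` I01) + Gamma (above h `&` I01) = 1)%E.
  rewrite -Gamma01 -measureU//; try exact: measurableI.
    rewrite -setIUl (_ : below h `|` above h = setT) ?setTI//.
    by apply/seteqP; split => x //= _; rewrite /below /above /=; case: ltP; [left|right].
  apply/seteqP; split => x //= [[+ _] [+ _]].
  by rewrite /below /above /= => /lt_le_trans h' /h'; rewrite ltxx.
rewrite -(fineK (fin_num_measure Gamma _ (measurableI _ _ mb (measurable_itv `[0%R, 1%R])))).
rewrite -(fineK (fin_num_measure Gamma _ (measurableI _ _ ma (measurable_itv `[0%R, 1%R])))).
move=> [] e; rewrite !lee_fin; lra.
Qed.

Lemma regular_c0_le1 : c0 <= 1.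
Proof.
have := le_trans (measure_ge0 Gamma _) (prior_capped_le ltr01 (lexx 1)).
by rewrite lee_fin mulr1 subr_ge0.
Qed.

Lemma regular_C0_ge1 : 1 <= C0.
Proof.
have h2 : 2 * 2^-1 = 1 :> R by rewrite divff.
(* At h = 1/2 the threshold 1 - 2h is 0, so [above h] contains [0,1] and has mass 1. *)
have := @prior_above_le 2^-1; rewrite h2 mulr1 -lee_fin setIidr ?Gamma01.
  by apply=> //; rewrite invr_gt0.
by move=> x /=; rewrite /above /= in_itv /= h2 subrr => /andP[].
Qed.
End regular.

(** * Elementary inequalities *)

(** A division-free form of (1 - x)^k <= 1 / (1 + k x); the induction uses (1 - x) (1 + (k+1) x) <=
    1 + k x. *)
Lemma expr_1B_le (R : realType) (x : R) k : 0 <= x -> x <= 1 ->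
  (1 - x) ^+ k * (1 + k%:R * x) <= 1.
Proof.
move=> x0 x1; elim: k => [|k IH]; first by rewrite expr0 mul0r; lra.
apply: le_trans IH; rewrite exprSr -mulrA ler_wpM2l ?exprn_ge0 ?subr_ge0//.
by rewrite -natr1; have : 0 <= k%:R :> R by []; nra.
Qed.

(** Here [r] is the regret, [s] the expected number of explored arms, [t] the horizon and [m] the
    minimum of its root and [k]. Exploration is charged at the constant scale [h0], missed
    exploitation at the scale [h] = 1 / (c0 m). *)
Lemma regret_arithmetic (R : realType) (c0 C0 h0 h d m t s r : R) (k : nat) :
  0 < c0 -> 0 < C0 -> 0 < h0 -> 0 < d -> 0 < m -> 0 <= t -> 0 <= s ->
  c0 <= 1 -> h0 <= 1 -> 8 * C0 * d = c0 -> c0 * m * h = 1 ->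
  4 <= c0 * h0 * d * m -> m ^+ 2 <= t -> m <= k%:R -> c0 * h <= 1 ->
  h0 * (s / 2) <= r + h0 * k%:R * (1 - c0 * h0) ^+ k ->
  t * h <= r + t * h * (s * (C0 * (2 * h))) + t * h * (1 - c0 * h) ^+ k ->
  Num.min (h0 * d / 4) (1 / (4 * c0)) * m <= r.
Proof.
move=> c00 C00 h00 d0 m0 t0 s0 c01 h01 dE hE m4 mt mk ch1 K1 K2.
have h_gt0 : 0 < h.
  by rewrite -(pmulr_rgt0 _ (mulr_gt0 c00 m0)) hE.
have x01 : 0 <= c0 * h0 <= 1.
  by apply/andP; split; nra.
(* The error of the exploration bound is at most 1 / c0, uniformly in [k]. *)
have P1 : c0 * (h0 * k%:R * (1 - c0 * h0) ^+ k) <= 1.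
  have /andP[x0 x1] := x01; apply: le_trans (expr_1B_le k x0 x1).
  have : 0 <= (1 - c0 * h0) ^+ k by rewrite exprn_ge0// subr_ge0.
  by set w := _ ^+ k; nra.
(* As k >= m, k c0 h is at least 1: some mean exceeds 1 - h with probability at least 1/2. *)
have P2 : (1 - c0 * h) ^+ k <= 1 / 2.
  have ch0 : 0 <= c0 * h by rewrite mulr_ge0 ?ltW.
  have := expr_1B_le k ch0 ch1.
  have : 0 <= (1 - c0 * h) ^+ k by rewrite exprn_ge0// subr_ge0.
  have : 1 <= k%:R * (c0 * h).
    by have : 0 <= (k%:R - m) * (c0 * h); [rewrite mulr_ge0 ?subr_ge0|lra].
  by set w := _ ^+ k; nra.
have th0 : 0 <= t * h by rewrite mulr_ge0// ltW.
(* With s >= d m, exploration alone costs h0 d m / 2, and the error takes away at most half of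
   it. *)
have [sd|sd] := leP (d * m) s.
  apply: (@le_trans _ _ (h0 * d / 4 * m)).
    by apply: ler_wpM2r (ltW m0) _ _ _; rewrite ge_min lexx.
  have P3 : h0 * k%:R * (1 - c0 * h0) ^+ k <= h0 * d * m / 4.
    by rewrite -(ler_pM2l c00); apply: le_trans P1 _; lra.
  have : h0 * (d * m) <= h0 * s by rewrite ler_wpM2l// ltW.
  lra.
apply: (@le_trans _ _ (1 / (4 * c0) * m)).
  by apply: ler_wpM2r (ltW m0) _ _ _; rewrite ge_min lexx orbT.
(* The relation 8 C0 d = c0 is tuned to give 1/4 here; with the 1/2 from [P2], a quarter of t h is
   left for the regret. *)
have P3 : s * (C0 * (2 * h)) <= 1 / 4.
  have : s * (C0 * (2 * h)) <= d * m * (C0 * (2 * h)).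
    by apply: ler_wpM2r; [rewrite !mulr_ge0// ltW|exact: ltW].
  move=> /le_trans; apply.
  have -> : d * m * (C0 * (2 * h)) = 8 * C0 * d * m * h / 4 by lra.
  by rewrite dE hE.
have P4 : t * h * (s * (C0 * (2 * h))) <= t * h * (1 / 4) by rewrite ler_wpM2l.
have P5 : t * h * (1 - c0 * h) ^+ k <= t * h * (1 / 2) by rewrite ler_wpM2l.
(* This is where m <= sqrt T enters: t h >= m^2 h = m / c0. *)
have P6 : 1 / (4 * c0) * m <= t * h / 4.
  have -> : 1 / (4 * c0) * m = m ^+ 2 * h / 4.
    rewrite -[1]hE; field; lra.
  by rewrite ler_pdivrMr// divfK// ler_wpM2r// ltW.
lra.
Qed.

(** * Choice of the constants and conclusion *)

Theorem theorem1 (R : realType) (Gamma : probability R R)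
    (P : R -> probability R R) :
  abs_cont_prior Gamma -> one_regular Gamma -> reward_family P ->
  exists cD cL : R, 0 < cD /\ 0 < cL /\
    forall (T k : nat) (pi : policy R k), is_policy pi ->
      cD <= T%:R -> cD <= k%:R ->
      ((cL * Num.min (Num.sqrt T%:R) k%:R)%:E <= bayes_regret Gamma P pi T)%E.

Proof.
move=> [Gamma01 _] [c0 [C0 [c00 [_ reg0]]]] [_ mP].
have reg eps : 0 < eps -> eps <= 1 ->
    ((c0 * eps)%:E <= Gamma [set x : R | (1 - eps < x)%R])%E /\
    (Gamma [set x : R | (1 - eps <= x)%R] <= (C0 * eps)%:E)%E.
  by move=> e0 e1; have [H1 [_ H2]] := reg0 eps e0 e1.
have c01 := regular_c0_le1 reg; have C01 := regular_C0_ge1 Gamma01 reg.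
have C00 : 0 < C0 by exact: lt_le_trans C01.
(* With this [h0], [above h0] has mass at most C0 2 h0 = 1/2, so [below h0] keeps at least half of
   the prior. *)
pose h0 := 1 / (4 * C0); pose d := c0 / (8 * C0).
have h00 : 0 < h0 by rewrite divr_gt0// mulr_gt0.
have d0 : 0 < d by rewrite divr_gt0// mulr_gt0.
have h0E : h0 * C0 = 1 / 4 by rewrite /h0 invfM mulrA divfK// gt_eqF.
have dE : 8 * C0 * d = c0 by rewrite mulrC divfK// gt_eqF// mulr_gt0.
(* The threshold is K^2, so that sqrt T >= K; K >= 1 also gives k >= K. The bound 2 / c0 ensures 2h
   <= 1, and the last entry makes the error 1 / c0 at most h0 d m / 4. *)
pose K := Num.max 1 (Num.max (2 / c0) (4 / (c0 * h0 * d))).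
have K1 : 1 <= K by rewrite le_max lexx.
have K2 : 2 / c0 <= K by rewrite !le_max lexx orbT.
have K3 : 4 / (c0 * h0 * d) <= K by rewrite !le_max lexx !orbT.
exists (K ^+ 2), (Num.min (h0 * d / 4) (1 / (4 * c0))).
have K0 : 0 < K by exact: lt_le_trans K1.
split; first by rewrite exprn_gt0.
split; first by rewrite lt_min; apply/andP; split; rewrite divr_gt0// mulr_gt0.
move=> T k pi pi_policy KT Kk.
set m := Num.min (Num.sqrt T%:R) k%:R.
have Km : K <= m.
  rewrite le_min; apply/andP; split; last by apply: le_trans Kk; rewrite ler_eXnr.
  by rewrite -[K]ger0_norm ?(le_trans ler01)// -sqrtr_sqr ler_wsqrtr.
have m0 : 0 < m by exact: lt_le_trans Km.
have mT : m ^+ 2 <= T%:R.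
  rewrite -(sqr_sqrtr (ler0n R T)) ler_sqr ?nnegrE ?sqrtr_ge0 ?(ltW m0)//.
  by rewrite ge_min lexx.
have mk : m <= k%:R by rewrite ge_min lexx orbT.
pose h := 1 / (c0 * m).
have cm0 : 0 < c0 * m by rewrite mulr_gt0.
have hE : c0 * m * h = 1 by rewrite mulrC divfK// gt_eqF.
have h_gt0 : 0 < h by rewrite divr_gt0.
have cm2 : 2 <= c0 * m.
  by rewrite -ler_pdivrMl// mulrC (le_trans K2).
have h2 : 2 * h <= 1 by rewrite -[leRHS]hE; exact: (ler_wpM2r (ltW h_gt0) cm2).
have h1 : h <= 1 by clear - h2 h_gt0; lra.
have h01 : h0 <= 1 by clear - h0E h00 C01; nra.
have hC : C0 * (2 * h0) <= 2^-1 by clear - h0E; lra.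
have h02 : 2 * h0 <= 1 by clear - h0E h00 C01; nra.
have ch1 : c0 * h <= 1 by clear - h1 h_gt0 c01 c00; nra.
set BR := bayes_regret _ _ _ _.
(* An infinite regret satisfies the bound trivially; otherwise everything reduces to real
   numbers. *)
have [BRy|BRfin] := eqVneq BR +oo%E; first by rewrite BRy leey.
have BR0 : (0 <= BR)%E by exact: bayes_regret_ge0.
have BRE : BR = (fine BR)%:E by rewrite fineK// ge0_fin_numE// lt_neqAle BRfin leey.
have S0 := pulls_ge0 Gamma P pi_policy T.
have Sk := pulls_le Gamma01 mP pi_policy T.
set S := pulls _ _ _ _ in S0 Sk.
have SE : S = (fine S)%:E.
  by rewrite fineK// ge0_fin_numE// (le_lt_trans Sk)// ltry.
have fin_capped x : exists2 q, Gamma (capped x `&` `[0%R, 1%R]%classic) = q%:E & 0 <= q.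
  have mc : measurable (capped x `&` `[0%R, 1%R]%classic : set R).
    by apply: measurableI => //; exact: measurable_capped.
  exists (fine (Gamma (capped x `&` `[0%R, 1%R]%classic))); last exact/fine_ge0.
  by rewrite fineK// fin_num_measure.
rewrite BRE lee_fin.
apply: (@regret_arithmetic _ c0 C0 h0 h d m T%:R (fine S) _ k) => //.
- exact: fine_ge0.
- rewrite mulrC -ler_pdivrMr; first exact: (le_trans K3 Km).
  by apply: mulr_gt0 => //; exact: mulr_gt0.
- have [q qE q0] := fin_capped h0.
  have := bayes_exploration_bound Gamma01 mP pi_policy T (ltW h00) qE.
  rewrite -/BR -/S BRE => B1.
  have q1 : q <= 1 - c0 * h0 by rewrite -lee_fin -qE (prior_capped_le reg).
  rewrite -lee_fin; apply: (@le_trans _ _ (h0%:E * (S * Gamma (below h0 `&` `[0%R, 1%R]%classic)))%E).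
    rewrite (EFinM h0) (EFinM (fine S)) -SE; apply: lee_wpmul2l; first by rewrite lee_fin ltW.
    apply: lee_wpmul2l => //; exact: (prior_below_ge Gamma01 reg).
  apply: le_trans B1 _; rewrite -EFinD lee_fin lerD2l.
  apply: ler_wpM2l; first by apply: mulr_ge0 => //; exact: ltW.
  by rewrite lerXn2r// nnegrE (le_trans q0).
- have [q qE q0] := fin_capped h.
  have Th0 : 0 <= T%:R * h by rewrite mulr_ge0// ltW.
  have := bayes_exploitation_bound Gamma01 mP pi_policy T (ltW h_gt0) qE.
  rewrite -/BR -/S BRE => B1.
  have q1 : q <= 1 - c0 * h by rewrite -lee_fin -qE (prior_capped_le reg).
  rewrite -lee_fin; apply: le_trans B1 _; rewrite !EFinD; apply: leeD.
    apply: leeD => //; rewrite (EFinM (T%:R * h)) (EFinM (fine S)) -SE.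
    by apply: lee_wpmul2l; rewrite ?lee_fin//; apply: lee_wpmul2l => //; exact: (prior_above_le reg).
  by rewrite lee_fin ler_wpM2l// lerXn2r// nnegrE (le_trans q0).
Qed.
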